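(* Let $n\ge 2$ and let $\Omega=[A_0,A_1,\dots,A_n]$ be a circumscriptible $n$-simplex in Euclidean $n$-space with circumradius $R$, edge-inradius $\rho$, circumcenter $O$ and centroid $G$. Then $$0\le R^2-\frac{2n}{n-1}\rho^2\le (n+1)^2|OG|^2.$$
   Context: An $n$-simplex $\Omega=[A_0,\dots,A_n]$ is the convex hull of $n+1$ affinely independent points $A_0,\dots,A_n$ (its vertices) in Euclidean $n$-space. Its edges are the $n(n+1)/2$ line segments joining two different vertices $A_i,A_j$. The circumradius $R$ and circumcenter $O$ are the radius and center of the unique sphere passing through all $n+1$ vertices. The centroid is $G=\frac{1}{n+1}\sum_{i=0}^n A_i$, and $|OG|$ is the Euclidean distance from $O$ to $G$. The simplex is called circumscriptible (or edge-incentric) if there is a sphere tangent to all its $n(n+1)/2$ edges (the edges being line segments, so each point of tangency lies on the edge); equivalently, there exist real numbers $x_0,\dots,x_n>0$ such that the edge $A_iA_j$ has length $x_i+x_j$ for all $0\le i<j\le n$. This sphere is the edge-tangent sphere, and its radius $\rho$ is called the edge-inradius. *)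

(* Defs.v *)
From mathcomp Require Import all_boot all_order all_algebra.
From mathcomp Require Import classical_sets reals.

Set Implicit Arguments.
Unset Strict Implicit.
Unset Printing Implicit Defensive.

Import GRing.Theory Num.Theory.
Local Open Scope classical_set_scope.
Local Open Scope ring_scope.

(* MathComp-Analysis norms 'rV[R]_n with the sup norm, so the Euclidean
   distance is defined here. *)
Definition edist (R : realType) n (P Q : 'rV[R]_n) : R :=
  Num.sqrt (\sum_(i < n) (P 0 i - Q 0 i) ^+ 2).

Definition sphere (R : realType) n (C : 'rV[R]_n) (r : R) : set 'rV[R]_n :=
  [set P | edist C P = r].

Definition line (R : realType) n (P Q : 'rV[R]_n) : set 'rV[R]_n :=
  [set (1 - t) *: P + t *: Q | t in [set: R]].

Definition segment (R : realType) n (P Q : 'rV[R]_n) : set 'rV[R]_n :=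
  [set (1 - t) *: P + t *: Q | t in [set t : R | 0 <= t <= 1]].

Definition affinely_independent (R : realType) n m (A : 'I_m -> 'rV[R]_n) :=
  forall c : 'I_m -> R,
    \sum_i c i = 0 -> \sum_i c i *: A i = 0 -> forall i, c i = 0.

(* An n-simplex is represented by the family of its n + 1 vertices. *)
Definition is_simplex (R : realType) n (A : 'I_n.+1 -> 'rV[R]_n) :=
  affinely_independent A.

Definition is_circumsphere (R : realType) n (A : 'I_n.+1 -> 'rV[R]_n)
    (O : 'rV[R]_n) (r : R) :=
  forall i, sphere O r (A i).

Definition centroid (R : realType) n (A : 'I_n.+1 -> 'rV[R]_n) : 'rV[R]_n :=
  n.+1%:R^-1 *: \sum_i A i.

(* The line through P and Q is tangent to the sphere, i.e. meets it in exactly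
   one point, and this point of tangency lies on the segment [P, Q]. *)
Definition tangent_to_segment (R : realType) n (C : 'rV[R]_n) (r : R)
    (P Q : 'rV[R]_n) :=
  exists2 T, segment P Q T & line P Q `&` sphere C r = [set T].

(* A circumscriptible simplex is one that has an edge-tangent sphere. *)
Definition is_edge_tangent_sphere (R : realType) n
    (A : 'I_n.+1 -> 'rV[R]_n) (C : 'rV[R]_n) (rho : R) :=
  0 < rho /\
  forall i j : 'I_n.+1, i != j -> tangent_to_segment C rho (A i) (A j).

(* Main.v *)
Require Import Defs.
From mathcomp Require Import all_boot all_order all_algebra.
From mathcomp Require Import classical_sets reals.
From mathcomp Require Import ring lra zify.

Import Order.TTheory GRing.Theory Num.Theory.
Local Open Scope ring_scope.

(** Put the origin at the center [C] of the edge-tangent sphere and let [a i] be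
    the vertices and [x i] the tangent lengths.  All edges at a vertex have the
    same tangent length, so the Gram matrix of the [a i] is known:
    [|a i|^2 = rho^2 + x i^2] and [a i . a j = rho^2 - x i * x j].  It is a
    diagonal matrix plus a matrix of rank two, so linear systems in it can be
    solved explicitly.  Two of them matter.

    - The barycentric coordinates of [C] span the kernel.  With
      [p = sum 1/x i], [q = sum 1/x i^2], [s = sum x i], this gives
      [rho^2 (p^2 - (n-1) q) = 2 (n-1)] and the power of [C] with respect to the
      circumsphere, [R^2 - |OC|^2 = rho^2/2 (p s / (n-1) - (n-1))].  As
      [p s >= (n+1)^2], the lower bound follows, even with [R^2 - |OC|^2] in
      place of [R^2].
    - The coordinates of [O] relative to the vertices give [|OC|^2], hence
      [|OG|^2], in terms of [rho], [p], [s] and [Q = sum x i^2].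

    The upper bound thus becomes an inequality between [p], [q], [s] and [Q].
    In terms of the defect [d = p s - (n+1)^2] and the spreads
    [V = (n+1) q - p^2], [W = (n+1) Q - s^2], all nonnegative and all zero for
    the regular simplex, the difference of its two sides is, up to a positive
    factor,
      [n (n^2 + 5 n - 26) d^2 + 4 n (3 n - 10) (n+1)^2 d
       + 6 n (3 n - 2) V s^2 + (n-2) (n-4) W (2 p^2 - (n-1) V)]
    (lemma [defect_identity]).  The last factor is [(n+1) (p^2 - (n-1) q)], which
    is positive by the first relation, so for [n >= 4] every term is
    nonnegative.  For [n = 3] the negative terms are absorbed by [V s^2], thanks
    to [d^2 <= V W], [4 d <= V s^2], [W <= 3 s^2] and [p^2 W <= 27 V s^2].
    For a triangle the inequality is Gerretsen's, and it says that the
    squared distance from the incenter to the orthocenter is nonnegative. *)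

(** * The Euclidean scalar product *)

Definition dot {R : realType} {n : nat} (u v : 'rV[R]_n) : R :=
  \sum_i u 0 i * v 0 i.

Lemma dotC {R : realType} {n : nat} (u v : 'rV[R]_n) : dot u v = dot v u.
Proof. by apply: eq_bigr => i _; rewrite mulrC. Qed.

Lemma dotDl {R : realType} {n : nat} (u v w : 'rV[R]_n) :
  dot (u + v) w = dot u w + dot v w.
Proof. by rewrite -big_split; apply: eq_bigr => i _; rewrite mxE mulrDl. Qed.

Lemma dotZl {R : realType} {n : nat} (t : R) (u v : 'rV[R]_n) :
  dot (t *: u) v = t * dot u v.
Proof. by rewrite mulr_sumr; apply: eq_bigr => i _; rewrite mxE mulrA. Qed.

Lemma dotNl {R : realType} {n : nat} (u v : 'rV[R]_n) : dot (- u) v = - dot u v.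
Proof. by rewrite -scaleN1r dotZl mulN1r. Qed.

Lemma dotDr {R : realType} {n : nat} (u v w : 'rV[R]_n) :
  dot w (u + v) = dot w u + dot w v.
Proof. by rewrite dotC dotDl !(dotC w). Qed.

Lemma dotZr {R : realType} {n : nat} (t : R) (u v : 'rV[R]_n) :
  dot v (t *: u) = t * dot v u.
Proof. by rewrite dotC dotZl dotC. Qed.

Lemma dotNr {R : realType} {n : nat} (u v : 'rV[R]_n) : dot v (- u) = - dot v u.
Proof. by rewrite dotC dotNl dotC. Qed.

Definition dotE := (@dotDl, @dotDr, @dotNl, @dotNr, @dotZl, @dotZr).

Lemma dot_sumr {R : realType} {n : nat} {I : finType} (u : 'rV[R]_n)
    (w : I -> R) (a : I -> 'rV[R]_n) :
  dot u (\sum_i w i *: a i) = \sum_i w i * dot u (a i).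
Proof.
rewrite (big_morph (dot u) (id1 := 0) (op1 := +%R)).
- by apply: eq_bigr => i _; rewrite dotZr.
- by move=> v v'; rewrite dotDr.
- by rewrite /dot big1 // => i _; rewrite mxE mulr0.
Qed.

Lemma dot_ge0 {R : realType} {n : nat} (u : 'rV[R]_n) : 0 <= dot u u.
Proof. by apply: sumr_ge0 => i _; rewrite -expr2 sqr_ge0. Qed.

Lemma dot_eq0 {R : realType} {n : nat} (u : 'rV[R]_n) : dot u u = 0 -> u = 0.
Proof.
move=> /eqP; rewrite psumr_eq0 => [/allP u0|i _]; last by rewrite -expr2 sqr_ge0.
apply/rowP => i; rewrite mxE; apply/eqP.
by have := u0 i (mem_index_enum i); rewrite /= mulf_eq0 orbb.
Qed.

Lemma edist_sqr {R : realType} {n : nat} (P Q : 'rV[R]_n) :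
  edist P Q ^+ 2 = dot (P - Q) (P - Q).
Proof.
rewrite sqr_sqrtr; last by apply: sumr_ge0 => i _; rewrite sqr_ge0.
by apply: eq_bigr => i _; rewrite !mxE expr2.
Qed.

Lemma edist_ge0 {R : realType} {n : nat} (P Q : 'rV[R]_n) : 0 <= edist P Q.
Proof. exact: sqrtr_ge0. Qed.

(** * Barycentric coordinates *)

(** The rows [(1, A i)] form a square matrix, which affine independence makes
    invertible.  Total weight [1] gives the barycentric coordinates of a point,
    total weight [0] those of a vector. *)
Lemma simplex_coordinates {R : realType} {n : nat} {A : 'I_n.+1 -> 'rV[R]_n}
    (hA : is_simplex A) (t : R) (P : 'rV[R]_n) :
  exists2 w : 'I_n.+1 -> R, \sum_i w i = t & \sum_i w i *: A i = P.
Proof.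
pose M : 'M[R]_(n.+1, 1 + n) := \matrix_i row_mx (1%:M : 'M_1) (A i).
have MN (w : 'rV[R]_n.+1) :
    w *m M = row_mx (\sum_i w 0 i)%:M (\sum_i w 0 i *: A i).
  rewrite mulmx_sum_row; under eq_bigr do rewrite rowK scale_row_mx.
  apply/rowP => j; rewrite summxE [RHS]mxE; under eq_bigr do rewrite mxE.
  case: split => k.
    by rewrite !mxE (ord1 k) mulr1n; apply: eq_bigr => i _; rewrite !mxE mulr1.
  by rewrite summxE; apply: eq_bigr => i _; rewrite !mxE.
have Mfree : row_free M.
  rewrite -kermx_eq0; apply/eqP/row_matrixP => i; rewrite row0.
  have /sub_kermxP := row_sub i (kermx M).
  rewrite MN -[RHS]row_mx0 => /eq_row_mx [w0 wA0].
  apply/rowP => j; rewrite [RHS](mxE _ (fun _ _ => 0)).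
  apply: (hA (row i (kermx M) 0)) => //.
  by have /matrixP /(_ 0 0) := w0; rewrite !mxE eqxx mulr1n.
have /submxP [w] : (row_mx t%:M P <= M)%MS.
  by apply: submx_full; rewrite /row_full -[X in _ == X]/(n.+1).
rewrite MN => /eq_row_mx [wt wP]; exists (w 0) => //.
by have /matrixP /(_ 0 0) := wt; rewrite !mxE eqxx !mulr1n.
Qed.

(** * Tangent lengths and the Gram matrix *)

(** At the point of tangency the radius is orthogonal to the edge: otherwise the
    reflection of that point in the foot of the perpendicular from the center
    would be a second common point.  As the point lies on the segment, both
    tangent lengths are nonnegative multiples of the edge length, which fixes
    the sign of [x * y]. *)
Lemma tangency_lengths {R : realType} {n : nat} {C P Q : 'rV[R]_n} {rho : R}
    (hPQ : tangent_to_segment C rho P Q) :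
  exists x y : R, [/\ 0 <= x, 0 <= y,
    dot (P - C) (P - C) = rho ^+ 2 + x ^+ 2,
    dot (Q - C) (Q - C) = rho ^+ 2 + y ^+ 2
  & dot (P - C) (Q - C) = rho ^+ 2 - x * y].
Proof.
case: hPQ => T [t /= /andP [t0 t1] defT] tanT.
have [_ CT] : (line P Q `&` sphere C rho)%classic T by rewrite tanT.
rewrite /sphere /= in CT.
have [d defd] : exists d, d = Q - P by eexists.
have [e defe] : exists e, e = T - C by eexists.
have ee : dot e e = rho ^+ 2.
  by rewrite -CT edist_sqr -(opprB T C) dotNl dotNr opprK defe.
have ed0 : dot e d = 0.
  have [d0|d0] := eqVneq d 0; first by rewrite d0 -[0](scale0r 0) dotZr mul0r.
  have dd : dot d d != 0 by apply: contra_neq d0 => /dot_eq0.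
  (* The second point at which the line meets the sphere. *)
  have [u defu] : exists u, u = - (2 * dot e d / dot d d) by eexists.
  have : (line P Q `&` sphere C rho)%classic (T + u *: d).
    split.
      exists (t + u) => //; rewrite -defT defd.
      by apply/rowP => j; rewrite !mxE; ring.
    apply/eqP; rewrite -(eqrXn2 (n := 2)) ?edist_ge0 //; last first.
      by rewrite -CT edist_ge0.
    rewrite edist_sqr -opprB dotNl dotNr opprK.
    rewrite (_ : T + u *: d - C = e + u *: d); last by rewrite defe addrAC.
    by rewrite !dotE ee (dotC d e) defu; apply/eqP; field.
  rewrite tanT => /= /eqP; rewrite -subr_eq0 addrAC subrr add0r scaler_eq0.
  rewrite (negPf d0) orbF defu oppr_eq0 !mulf_eq0 invr_eq0 (negPf dd) orbF.
  by rewrite pnatr_eq0 /= => /eqP.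
have [L defL] : exists L, L = edist P Q by eexists.
have dd : dot d d = L ^+ 2.
  by rewrite defL edist_sqr -(opprB Q P) -defd dotNl dotNr opprK.
have -> : P - C = e - t *: d.
  by rewrite defe defd -defT; apply/rowP => j; rewrite !mxE; ring.
have -> : Q - C = e + (1 - t) *: d.
  by rewrite defe defd -defT; apply/rowP => j; rewrite !mxE; ring.
exists (t * L), ((1 - t) * L); rewrite !dotE (dotC d e) ed0 ee dd.
by split; rewrite ?mulr_ge0 ?subr_ge0 ?defL ?edist_ge0 //; ring.
Qed.

(** The tangent length at a vertex is determined by its power with respect to
    the sphere, so the lengths found on different edges agree. *)
Lemma edge_tangent_gram {R : realType} {n : nat} (hn : (0 < n)%N)
    {A : 'I_n.+1 -> 'rV[R]_n} {C : 'rV[R]_n} {rho : R}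
    (hC : is_edge_tangent_sphere A C rho) :
  exists2 x : 'I_n.+1 -> R, forall i, 0 <= x i & forall i j,
    dot (A i - C) (A j - C) =
      rho ^+ 2 - x i * x j + (if i == j then 2 * x i ^+ 2 else 0).
Proof.
case: hC => _ tan.
pose x i := Num.sqrt (dot (A i - C) (A i - C) - rho ^+ 2).
have xE i (z : R) : 0 <= z -> dot (A i - C) (A i - C) = rho ^+ 2 + z ^+ 2 ->
    x i = z.
  by move=> z0 h; rewrite /x h addrAC subrr add0r sqrtr_sqr ger0_norm.
exists x => [i|i j]; first exact: sqrtr_ge0.
have [<-|ij] := eqVneq i j.
  have [k ik] : exists k : 'I_n.+1, i != k.
    exists (if i == ord0 then ord_max else ord0).
    have [->|//] := eqVneq i ord0; apply/eqP => /(congr1 val) /= n0.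
    by rewrite -n0 in hn.
  have [u [v [u0 _ hu _ _]]] := tangency_lengths (tan i k ik).
  by rewrite (xE i u) // hu; ring.
have [u [v [u0 v0 hu hv ->]]] := tangency_lengths (tan i j ij).
by rewrite (xE i u) // (xE j v) // addr0.
Qed.

(** Action of the Gram matrix on a vector of coefficients: it is diagonal up to
    a correction of rank two. *)
Lemma gram_action {R : realType} {n m : nat} {a : 'I_m -> 'rV[R]_n}
    {x : 'I_m -> R} {q : R}
    (gram : forall i j, dot (a i) (a j) =
      q - x i * x j + (if i == j then 2 * x i ^+ 2 else 0))
    (w : 'I_m -> R) (i : 'I_m) :
  dot (a i) (\sum_j w j *: a j) =
    2 * x i ^+ 2 * w i + q * (\sum_j w j) - x i * (\sum_j w j * x j).
Proof.
rewrite dot_sumr (eq_bigr (fun j =>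
  (if j == i then 2 * x i ^+ 2 * w i else 0)
  + (q * w j - x i * (w j * x j)))) => [|j _]; last first.
  rewrite gram eq_sym; case: eqVneq => [->|_]; ring.
by rewrite big_split /= sumrB -!mulr_sumr -big_mkcond big_pred1_eq addrA.
Qed.

(** * The metric relations *)

(** Solving for [w i] gives [(Z / x i + b / x i^2 + e) / 2]; summing it against
    the powers of [x] eliminates the unknowns [w] from the linear systems met
    below. *)
Lemma moments {R : realType} {m : nat} {x w : 'I_m -> R} {Z b e : R}
    (x0 : forall i, x i != 0)
    (hw : forall i, 2 * x i ^+ 2 * w i = Z * x i + b + e * x i ^+ 2) :
  [/\ 2 * (\sum_i w i) =
        Z * (\sum_i (x i)^-1) + b * (\sum_i (x i)^-1 ^+ 2) + e * m%:R,
      2 * (\sum_i w i * x i) =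
        Z * m%:R + b * (\sum_i (x i)^-1) + e * (\sum_i x i)
    & 2 * (\sum_i w i * x i ^+ 2) =
        Z * (\sum_i x i) + b * m%:R + e * (\sum_i x i ^+ 2)].
Proof.
have wE i : w i = (Z * (x i)^-1 + b * (x i)^-1 ^+ 2 + e) / 2.
  have x2 : 2 * x i ^+ 2 != 0 by rewrite mulf_neq0 ?expf_neq0 ?pnatr_eq0.
  by apply: (mulfI x2); rewrite hw; field.
have one : \sum_(i < m) 1 = m%:R :> R by rewrite sumr_const card_ord.
rewrite -one; split; rewrite !mulr_sumr -!big_split /=;
  by apply: eq_bigr => i _; rewrite wE; field.
Qed.

(** The first two relations come from the barycentric coordinates [c] of [C],
    the third one from the coordinates [d] of the vector from [C] to [O].  The last
    two expand the squared norms of [N * (O - C) - g] and [g - 2 * (O - C)],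
    where [g] is the sum of the vectors from [C] to the vertices; for a triangle
    the latter is the vector from the incenter to the orthocenter. *)
Lemma circumscriptible_relations {R : realType} {n : nat} (hn : (2 <= n)%N)
    {A : 'I_n.+1 -> 'rV[R]_n} (hA : is_simplex A)
    {O : 'rV[R]_n} {r : R} (hO : is_circumsphere A O r)
    {C : 'rV[R]_n} {rho : R} (hC : is_edge_tangent_sphere A C rho) :
  exists2 x : 'I_n.+1 -> R, forall i, 0 < x i &
  let m := n%:R - 1 in let N := n.+1%:R in
  let p := \sum_i (x i)^-1 in let q := \sum_i (x i)^-1 ^+ 2 in
  let s := \sum_i x i in let Q := \sum_i x i ^+ 2 in
  let OC := dot (O - C) (O - C) in
  [/\ rho ^+ 2 * (p ^+ 2 - m * q) = 2 * m,
      r ^+ 2 - OC = rho ^+ 2 / 2 * (p * s / m - m),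
      OC = Q / 8 - s ^+ 2 / (8 * m) + rho ^+ 2 / 16 * (N - p * s / m) ^+ 2,
      N ^+ 2 * edist O (centroid A) ^+ 2 =
        N ^+ 2 * OC - N * (N * rho ^+ 2 + Q + N * (OC - r ^+ 2))
        + (2 * Q + N ^+ 2 * rho ^+ 2 - s ^+ 2)
    & 0 <= 4 * OC - 2 * (N * rho ^+ 2 + Q + N * (OC - r ^+ 2))
        + (2 * Q + N ^+ 2 * rho ^+ 2 - s ^+ 2)].
Proof.
have [x x_ge0 gram] := edge_tangent_gram (ltnW hn) hC.
have rho_gt0 : 0 < rho by case: hC.
have m0 : n%:R - 1 != 0 :> R by rewrite subr_eq0 pnatr_eq1 gtn_eqF.
pose a i := A i - C.
have aE (w : 'I_n.+1 -> R) (P : 'rV[R]_n) : \sum_i w i *: A i = P ->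
    \sum_i w i *: a i = P - (\sum_i w i) *: C.
  move=> <-; rewrite scaler_suml -sumrB.
  by apply: eq_bigr => i _; rewrite scalerBr.
have [c c1 /aE] := simplex_coordinates hA 1 C.
rewrite c1 scale1r subrr => ca.
have gc i : 2 * x i ^+ 2 * c i + rho ^+ 2 - x i * (\sum_j c j * x j) = 0.
  have := gram_action gram c i; rewrite ca c1 mulr1 => <-.
  by rewrite -(scale0r 0) dotZr mul0r.
(* A vertex on the edge-tangent sphere would make the equation gc read
   rho ^+ 2 = 0. *)
have x_neq0 i : x i != 0.
  apply/eqP => xi0; have := gc i; rewrite xi0 expr0n !mul0r mulr0 mul0r add0r.
  by move/eqP; rewrite subr0 sqrf_eq0 gt_eqF.
exists x => [i|m N p q s Q OC]; first by rewrite lt0r x_neq0 x_ge0.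
have [d d0 /aE] := simplex_coordinates hA 0 (O - C).
rewrite d0 scale0r subr0 => da.
have ao i : 2 * dot (a i) (O - C) = rho ^+ 2 + x i ^+ 2 + (OC - r ^+ 2).
  have -> : r ^+ 2 = dot (O - A i) (O - A i) by rewrite -edist_sqr -(hO i).
  have -> : O - A i = (O - C) - a i by rewrite /a opprB addrA subrK.
  have := gram i i; rewrite eqxx -/(a i) /OC.
  move: (a i) (O - C) => u v; rewrite !dotE (dotC v u) => ->; ring.
pose X := \sum_j c j * x j; pose Y := \sum_j d j * x j.
have hc i : 2 * x i ^+ 2 * c i = X * x i + - rho ^+ 2 + 0 * x i ^+ 2.
  by apply/eqP; rewrite -subr_eq0 -[X in _ == X](gc i) -/X; apply/eqP; ring.
have hd i : 2 * x i ^+ 2 * d i =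
    Y * x i + (rho ^+ 2 + (OC - r ^+ 2)) / 2 + 2^-1 * x i ^+ 2.
  have := gram_action gram d i; rewrite da d0 => e.
  apply: (@mulfI _ 2); first by rewrite pnatr_eq0.
  have := ao i; rewrite e -/Y => e'.
  transitivity (rho ^+ 2 + x i ^+ 2 + (OC - r ^+ 2) + 2 * (x i * Y)).
    by rewrite -e'; ring.
  by field.
have [] := moments x_neq0 hc; rewrite c1 -/X -/N -/p -/q -/s => C1 C2 C3.
have [_] := moments x_neq0 hd; rewrite -/Y -/N -/p -/q -/s -/Q => D2 D3.
rewrite -/m in m0; have NE : N = m + 2 by rewrite /N /m -natr1; ring.
have cX : rho ^+ 2 + (OC - r ^+ 2) + \sum_i c i * x i ^+ 2 = 0.
  have : \sum_i c i * (2 * dot (a i) (O - C)) = 0.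
    under eq_bigr do rewrite dotC mulrCA.
    by rewrite -mulr_sumr -dot_sumr ca -(scale0r 0) dotZr mul0r mulr0.
  under eq_bigr do rewrite ao addrAC mulrDr.
  by rewrite big_split /= -mulr_suml c1 mul1r.
have dX : 2 * OC = \sum_i d i * x i ^+ 2.
  have : 2 * OC = \sum_i d i * (2 * dot (a i) (O - C)).
    under eq_bigr do rewrite dotC mulrCA.
    by rewrite -mulr_sumr -dot_sumr da.
  under eq_bigr do rewrite ao addrAC mulrDr.
  by rewrite big_split /= -mulr_suml d0 mul0r add0r.
pose g := \sum_i a i.
have gE : g = \sum_i 1 *: a i by apply: eq_bigr => i _; rewrite scale1r.
have NS : \sum_(i < n.+1) 1 = N by rewrite sumr_const card_ord.
have go : 2 * dot g (O - C) = N * rho ^+ 2 + Q + N * (OC - r ^+ 2).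
  rewrite gE dotC dot_sumr mulr_sumr -NS !mulr_suml -!big_split /=.
  by apply: eq_bigr => i _; rewrite dotC mul1r ao; ring.
have gg : dot g g = 2 * Q + N ^+ 2 * rho ^+ 2 - s ^+ 2.
  have ag i : dot (a i) g = 2 * x i ^+ 2 + rho ^+ 2 * N - x i * s.
    rewrite gE (gram_action gram (fun=> 1)) NS mulr1.
    by under [X in _ - _ * X]eq_bigr do rewrite mul1r.
  rewrite {2}gE dot_sumr; under eq_bigr do rewrite mul1r dotC ag.
  rewrite sumrB big_split /= -mulr_sumr -(mulr_suml _ _ _ s).
  by rewrite sumr_const card_ord -(mulr_natr _ n.+1) -/N -/Q -/s; ring.
have N0 : N != 0 by rewrite pnatr_eq0.
have OG : N ^+ 2 * edist O (centroid A) ^+ 2 =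
    dot (N *: (O - C) - g) (N *: (O - C) - g).
  rewrite edist_sqr (_ : N *: (O - C) - g = N *: (O - centroid A)).
    by rewrite dotZl dotZr mulrA.
  rewrite scalerBr scalerBr /centroid scalerA mulfV // scale1r /g /a sumrB.
  by rewrite sumr_const card_ord /N (scaler_nat _ C) opprB addrA subrK.
have gg' : 0 <= dot (g - 2 *: (O - C)) (g - 2 *: (O - C)) by exact: dot_ge0.
have mX : X = rho ^+ 2 * p / m.
  by apply: (mulIf m0); rewrite divfK //; move: C2; rewrite NE; lra.
have k : OC - r ^+ 2 = rho ^+ 2 / 2 * (m - p * s / m).
  move: cX C3; rewrite mX NE => /eqP; rewrite addr_eq0 => /eqP e C3.
  apply: (@mulfI _ 2); first by rewrite pnatr_eq0.
  transitivity (- (2 * rho ^+ 2 + 2 * \sum_i c i * x i ^+ 2)); first by lra.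
  by rewrite C3; field.
split.
- have : (rho ^+ 2 * (p ^+ 2 - m * q)) = m * (X * p - rho ^+ 2 * q).
    by rewrite mulrBr !mulrA mX; field.
  by move=> ->; rewrite -[X * p - _]addr0; rewrite mulrC; congr (_ * _); lra.
- by rewrite -opprB k; ring.
- have mY : Y = - (((rho ^+ 2 + (OC - r ^+ 2)) / 2 * p + s / 2) / m).
    by apply: (mulIf m0); rewrite mulNr divfK //; move: D2; rewrite NE; lra.
  have e : 4 * OC = 2 * (\sum_i d i * x i ^+ 2) by rewrite -dX; ring.
  apply: (@mulfI _ 4); first by rewrite pnatr_eq0.
  by rewrite e D3 mY k NE; field.
- rewrite OG -go -gg /OC; move: (O - C) (g) => u v.
  by rewrite !dotE (dotC v u); ring.
- move: gg'; rewrite -go -gg /OC; move: (O - C) (g) => u v.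
  by rewrite !dotE (dotC v u); lra.
Qed.

(** * Inequalities between the power sums *)

(** With [v = u], [v = 1 / u] this writes the spreads and the defect as sums
    over pairs of indices, which can be compared term by term. *)
Lemma lagrange_sum {R : realType} {m : nat} (u v : 'I_m -> R) :
  2 * (m%:R * (\sum_i u i * v i) - (\sum_i u i) * (\sum_i v i)) =
  \sum_i \sum_j (u i - u j) * (v i - v j).
Proof.
have inner i : \sum_j (u i - u j) * (v i - v j) =
    m%:R * (u i * v i) - u i * (\sum_j v j) - v i * (\sum_j u j)
    + \sum_j u j * v j.
  have -> : m%:R = \sum_(j < m) 1 :> R by rewrite sumr_const card_ord.
  rewrite mulr_suml !mulr_sumr -!sumrB -big_split /=.
  by apply: eq_bigr => j _; ring.
under [RHS]eq_bigr do rewrite inner.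
rewrite big_split /= !sumrB -mulr_sumr -!mulr_suml.
by rewrite sumr_const card_ord -(mulr_natr _ m); ring.
Qed.

Lemma cauchy_schwarz_sum {R : realType} {m : nat} (u v : 'I_m -> R) :
  (\sum_i u i * v i) ^+ 2 <= (\sum_i u i ^+ 2) * (\sum_i v i ^+ 2).
Proof.
have : 0 <= \sum_i \sum_j (u i * v j - u j * v i) ^+ 2.
  by apply: sumr_ge0 => i _; apply: sumr_ge0 => j _; exact: sqr_ge0.
have inner i : \sum_j (u i * v j - u j * v i) ^+ 2 =
    u i ^+ 2 * (\sum_j v j ^+ 2) - 2 * ((u i * v i) * (\sum_j u j * v j))
    + v i ^+ 2 * (\sum_j u j ^+ 2).
  rewrite !mulr_sumr -sumrB -big_split /=.
  by apply: eq_bigr => j _; ring.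
under eq_bigr do rewrite inner.
by rewrite big_split /= sumrB -mulr_sumr -!mulr_suml; lra.
Qed.

Lemma harmonic_bound {R : realType} {m : nat} {x : 'I_m -> R}
    (x0 : forall i, 0 < x i) :
  m%:R ^+ 2 <= (\sum_i (x i)^-1) * (\sum_i x i).
Proof.
have := lagrange_sum (fun i => (x i)^-1) x.
under [\sum_i (x i)^-1 * x i]eq_bigr do rewrite mulVf ?gt_eqF //.
rewrite sumr_const card_ord -(mulr_natr _ m) mul1r => e.
suff : \sum_i \sum_j ((x i)^-1 - (x j)^-1) * (x i - x j) <= 0.
  by rewrite -e; lra.
rewrite -oppr_ge0 -sumrN; apply: sumr_ge0 => i _; rewrite -sumrN.
apply: sumr_ge0 => j _.
have [xi xj] := (lt0r_neq0 (x0 i), lt0r_neq0 (x0 j)).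
rewrite (_ : - (_ * _) = (x i - x j) ^+ 2 / (x i * x j)); last first.
  by field; rewrite xi xj.
by rewrite divr_ge0 ?sqr_ge0 // mulr_ge0 // ltW.
Qed.

Lemma sum_sqr_le_sqr_sum {R : realType} {m : nat} {x : 'I_m -> R}
    (x0 : forall i, 0 <= x i) :
  \sum_i x i ^+ 2 <= (\sum_i x i) ^+ 2.
Proof.
rewrite [leRHS]expr2 mulr_suml; apply: ler_sum => i _; rewrite expr2.
apply: ler_wpM2l => //; rewrite (bigD1 i) //= lerDl.
exact: sumr_ge0.
Qed.

Lemma pair_le_sum {R : realType} {m : nat} {x : 'I_m -> R}
    (x0 : forall i, 0 <= x i) (i j : 'I_m) :
  i != j -> x i + x j <= \sum_k x k.
Proof.
move=> ij; rewrite (bigD1 i) //= (bigD1 j) 1?eq_sym //= addrA lerDl.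
exact: sumr_ge0.
Qed.

(** Pair by pair, [- (1/x i - 1/x j) (x i - x j)] is [x i * x j] times
    [(1/x i - 1/x j)^2], and [4 x i x j <= (x i + x j)^2 <= s^2]. *)
Lemma defect_le_spread {R : realType} {m : nat} {x : 'I_m -> R}
    (x0 : forall i, 0 < x i) :
  4 * ((\sum_i (x i)^-1) * (\sum_i x i) - m%:R ^+ 2) <=
  (m%:R * (\sum_i (x i)^-1 ^+ 2) - (\sum_i (x i)^-1) ^+ 2)
    * (\sum_i x i) ^+ 2.
Proof.
have := lagrange_sum (fun i => (x i)^-1) x.
under [\sum_i (x i)^-1 * x i]eq_bigr do rewrite mulVf ?gt_eqF //.
rewrite sumr_const card_ord -(mulr_natr _ m) mul1r => e1.
have := lagrange_sum (fun i => (x i)^-1) (fun i => (x i)^-1).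
under [\sum_i (x i)^-1 * (x i)^-1]eq_bigr do rewrite -expr2.
rewrite -expr2 => e2.
suff : - (4 * \sum_i \sum_j ((x i)^-1 - (x j)^-1) * (x i - x j)) <=
    (\sum_i \sum_j ((x i)^-1 - (x j)^-1) * ((x i)^-1 - (x j)^-1))
      * (\sum_i x i) ^+ 2.
  by rewrite -e1 -e2; lra.
rewrite -mulrN -sumrN mulr_sumr mulr_suml; apply: ler_sum => i _.
rewrite -sumrN mulr_sumr mulr_suml; apply: ler_sum => j _.
have [->|ij] := eqVneq i j; first by rewrite !subrr !(mul0r, oppr0, mulr0).
have [xi xj] := (lt0r_neq0 (x0 i), lt0r_neq0 (x0 j)).
rewrite (_ : 4 * _ = ((x i)^-1 - (x j)^-1) ^+ 2 * (4 * (x i * x j))); last first.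
  by field; rewrite xi xj.
rewrite -expr2; apply: ler_wpM2l; first exact: sqr_ge0.
have := pair_le_sum (fun k => ltW (x0 k)) i j ij; move: (x0 i) (x0 j).
move: (x i) (x j) (\sum_k _) => a b S a0 b0 abS.
apply: (@le_trans _ _ ((a + b) ^+ 2)); first by have := sqr_ge0 (a - b); lra.
by rewrite lerXn2r ?nnegrE; lra.
Qed.

(** Only pairs containing the index [h] of the smallest [x] are used.  They
    control the spread of [x] from above and bound that of the inverses from
    below, and on such a pair
    [p <= (m+1) (1/x j + 1/x h) <= (m+1) s / (x j * x h)]. *)
Lemma spread_comparison {R : realType} {m : nat} {x : 'I_m.+2 -> R}
    (x0 : forall i, 0 < x i) :
  (\sum_i (x i)^-1) ^+ 2 *
    (m.+2%:R * (\sum_i x i ^+ 2) - (\sum_i x i) ^+ 2) <=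
  m.+1%:R ^+ 3 *
   ((m.+2%:R * (\sum_i (x i)^-1 ^+ 2) - (\sum_i (x i)^-1) ^+ 2)
    * (\sum_i x i) ^+ 2).
Proof.
have [h xh] : exists h, forall j, x h <= x j.
  by case: (arg_minP x (isT : xpredT ord0)) => h _ hh; exists h => j; apply: hh.
set s := \sum_i x i; set p := \sum_i (x i)^-1.
have W : m.+2%:R * (\sum_i x i ^+ 2) - s ^+ 2 <=
    m.+1%:R * \sum_j (x j - x h) ^+ 2.
  have e1 := lagrange_sum x x.
  have e2 := lagrange_sum (fun j => x j - x h) (fun j => x j - x h).
  have : \sum_j (x j - x h) ^+ 2 <= (\sum_j (x j - x h)) ^+ 2.
    by apply: sum_sqr_le_sqr_sum => j; rewrite subr_ge0.
  have e3 : \sum_i \sum_j (x i - x h - (x j - x h)) * (x i - x h - (x j - x h)) =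
      \sum_i \sum_j (x i - x j) * (x i - x j).
    by apply: eq_bigr => i _; apply: eq_bigr => j _; ring.
  rewrite {}e3 -{}e1 -/s in e2.
  under [\sum_(i < m.+2) x i * x i]eq_bigr do rewrite -expr2 in e2.
  under [\sum_i (x i - x h) * _]eq_bigr do rewrite -expr2 in e2.
  by rewrite -(natr1 m.+1) in e2 *; lra.
have V : \sum_j ((x j)^-1 - (x h)^-1) ^+ 2 <=
    m.+2%:R * (\sum_i (x i)^-1 ^+ 2) - p ^+ 2.
  have := lagrange_sum (fun j => (x j)^-1) (fun j => (x j)^-1); rewrite -/p.
  under [\sum_i (x i)^-1 * (x i)^-1]eq_bigr do rewrite -expr2.
  rewrite [X in _ = X](bigD1 h) //=.
  have -> : \sum_j ((x h)^-1 - (x j)^-1) * ((x h)^-1 - (x j)^-1) =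
      \sum_j ((x j)^-1 - (x h)^-1) ^+ 2 by apply: eq_bigr => j _; ring.
  suff : \sum_j ((x j)^-1 - (x h)^-1) ^+ 2 <= \sum_(i | i != h)
      \sum_j ((x i)^-1 - (x j)^-1) * ((x i)^-1 - (x j)^-1).
    by move=> ? ?; lra.
  rewrite (bigD1 h) //= subrr expr0n add0r; apply: ler_sum => i _.
  rewrite (bigD1 h) //= -expr2 lerDl; apply: sumr_ge0 => j _.
  by rewrite -expr2 sqr_ge0.
have pair j : p ^+ 2 * (x j - x h) ^+ 2 <=
    m.+1%:R ^+ 2 * (s ^+ 2 * ((x j)^-1 - (x h)^-1) ^+ 2).
  have [->|jh] := eqVneq j h; first by rewrite !subrr expr0n !mulr0.
  have [xj xh0] := (lt0r_neq0 (x0 j), lt0r_neq0 (x0 h)).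
  have ph : p <= m.+1%:R * (s * ((x j)^-1 * (x h)^-1)).
    apply: (@le_trans _ _ (m.+1%:R * ((x j)^-1 + (x h)^-1))).
      rewrite /p (bigD1 j) //= mulrDr; apply: lerD.
        by rewrite ler_peMl ?ler1n // invr_ge0 ltW.
      rewrite (_ : m.+1%:R * _ = \sum_(i | i != j) (x h)^-1).
        by apply: ler_sum => i _; rewrite lef_pV2 ?posrE.
      by rewrite sumr_const cardC1 card_ord mulr_natl.
    apply: ler_wpM2l => //.
    rewrite (_ : _ + _ = (x j + x h) * ((x j)^-1 * (x h)^-1)).
      by apply: ler_wpM2r; [rewrite mulr_ge0 ?invr_ge0 ?ltW
        | exact: (pair_le_sum (fun k => ltW (x0 k)))].
    by field; rewrite xj xh0.
  rewrite (_ : (x j - x h) ^+ 2 =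
      (x j * x h) ^+ 2 * ((x j)^-1 - (x h)^-1) ^+ 2); last by field; rewrite xj xh0.
  rewrite [leLHS]mulrA [leRHS]mulrA -[p ^+ 2 * _]exprMn -[_ * s ^+ 2]exprMn.
  apply: ler_wpM2r; first exact: sqr_ge0.
  have y0 i : 0 <= (x i)^-1 by rewrite invr_ge0 ltW.
  have xx0 : 0 <= x j * x h by rewrite mulr_ge0 // ltW.
  rewrite lerXn2r ?nnegrE //.
  - by apply: mulr_ge0 => //; apply: sumr_ge0.
  - by apply: mulr_ge0 => //; apply: sumr_ge0 => i _; rewrite ltW.
  have -> : m.+1%:R * s = m.+1%:R * (s * ((x j)^-1 * (x h)^-1)) * (x j * x h).
    by field; rewrite xj xh0.
  by apply: ler_wpM2r ph.
apply: le_trans (ler_wpM2l (sqr_ge0 p) W) _.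
have pairs : p ^+ 2 * (\sum_j (x j - x h) ^+ 2) <=
    m.+1%:R ^+ 2 * (s ^+ 2 * \sum_j ((x j)^-1 - (x h)^-1) ^+ 2).
  by rewrite !mulr_sumr; apply: ler_sum => j _.
rewrite mulrCA [_ ^+ 3]exprS -[leRHS]mulrA; apply: ler_wpM2l => //.
apply: (le_trans pairs); apply: ler_wpM2l; first exact: sqr_ge0.
by rewrite [leRHS]mulrC; apply: ler_wpM2l V; exact: sqr_ge0.
Qed.

(** With three variables both factors on the left are twice an elementary
    symmetric function of degree two. *)
Lemma triangle_identity {R : realType} {x : 'I_3 -> R}
    (x0 : forall i, x i != 0) :
  ((\sum_i (x i)^-1) ^+ 2 - \sum_i (x i)^-1 ^+ 2)
    * ((\sum_i x i) ^+ 2 - \sum_i x i ^+ 2) =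
  4 * ((\sum_i (x i)^-1) * (\sum_i x i)).
Proof. by rewrite !big_ord_recr !big_ord0 /=; field; rewrite !x0. Qed.

(** * The upper bound as a sum of nonnegative terms *)

(** Once [rho2], [r2] and [OC] are eliminated, the gap in the upper bound is a
    polynomial in [p], [q], [s], [Q] divided by [p^2 - (n-1) q]; it is written
    here in the quantities [d], [V], [W] that vanish for the regular simplex. *)
Lemma defect_identity {R : realType} (n rho2 p q s Q OC r2 : R) :
  n - 1 != 0 -> p ^+ 2 - (n - 1) * q != 0 ->
  let m := n - 1 in let N := n + 1 in
  let d := p * s - N ^+ 2 in
  let V := N * q - p ^+ 2 in let W := N * Q - s ^+ 2 in
  rho2 * (p ^+ 2 - m * q) = 2 * m ->
  r2 - OC = rho2 / 2 * (p * s / m - m) ->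
  OC = Q / 8 - s ^+ 2 / (8 * m) + rho2 / 16 * (N - p * s / m) ^+ 2 ->
  16 * m * N ^+ 2 *
    (N ^+ 2 * OC - N * (N * rho2 + Q + N * (OC - r2))
     + (2 * Q + N ^+ 2 * rho2 - s ^+ 2) - (r2 - 2 * n / m * rho2)) =
  rho2 * (n * (n ^+ 2 + 5 * n - 26) * d ^+ 2
    + 4 * n * (3 * n - 10) * N ^+ 2 * d
    + 6 * n * (3 * n - 2) * V * s ^+ 2
    + (n - 2) * (n - 4) * W * (2 * p ^+ 2 - m * V)).
Proof.
move=> m0 D0 m N d V W e1 /eqP; rewrite subr_eq => /eqP -> ->.
have -> : rho2 = 2 * m / (p ^+ 2 - m * q) by rewrite -e1 mulfK.
rewrite /d /V /W /N /m; field.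
by rewrite m0 D0.
Qed.

(** For [n = 3] the coefficients of [d^2], [d] and [p^2 W] are negative; a
    dimension of at least four makes every term nonnegative. *)
Lemma defect_ge0 {R : realType} {n : nat} (hn : (3 <= n)%N) {x : 'I_n.+1 -> R}
    (x0 : forall i, 0 < x i) :
  let N := n%:R + 1 in
  let p := \sum_i (x i)^-1 in let q := \sum_i (x i)^-1 ^+ 2 in
  let s := \sum_i x i in let Q := \sum_i x i ^+ 2 in
  let d := p * s - N ^+ 2 in
  let V := N * q - p ^+ 2 in let W := N * Q - s ^+ 2 in
  0 < p ^+ 2 - (n%:R - 1) * q ->
  0 <= n%:R * (n%:R ^+ 2 + 5 * n%:R - 26) * d ^+ 2
    + 4 * n%:R * (3 * n%:R - 10) * N ^+ 2 * d
    + 6 * n%:R * (3 * n%:R - 2) * V * s ^+ 2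
    + (n%:R - 2) * (n%:R - 4) * W * (2 * p ^+ 2 - (n%:R - 1) * V).
Proof.
move=> N p q s Q d V W D0.
have NE : N = n.+1%:R by rewrite /N natr1.
have d0 : 0 <= d by rewrite subr_ge0 NE; exact: harmonic_bound.
have dV : 4 * d <= V * s ^+ 2.
  by rewrite /d /V NE; exact: defect_le_spread.
have N0 : 0 < N by rewrite NE ltr0Sn.
have cov (u v : 'I_n.+1 -> R) :
    \sum_i (N * u i - \sum_j u j) * (N * v i - \sum_j v j) =
    N * (N * (\sum_i u i * v i) - (\sum_j u j) * (\sum_j v j)).
  rewrite (eq_bigr (fun i => N ^+ 2 * (u i * v i) - N * (\sum_j v j) * u i
    - N * (\sum_j u j) * v i + (\sum_j u j) * (\sum_j v j))) => [|i _]; last by ring.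
  rewrite big_split !sumrB -!mulr_sumr sumr_const card_ord.
  by rewrite -(mulr_natr _ n.+1) -NE /=; ring.
have varV : \sum_i (N * (x i)^-1 - p) ^+ 2 = N * V.
  rewrite /V /q; under eq_bigr do rewrite expr2.
  by under [\sum_i _ ^-1 ^+ 2]eq_bigr do rewrite expr2; rewrite expr2 -cov.
have varW : \sum_i (N * x i - s) ^+ 2 = N * W.
  rewrite /W /Q; under eq_bigr do rewrite expr2.
  by under [\sum_i _ ^+ 2]eq_bigr do rewrite expr2; rewrite expr2 -cov.
have V0 : 0 <= V.
  by rewrite -(pmulr_rge0 _ N0) -varV; apply: sumr_ge0 => i _; exact: sqr_ge0.
have W0 : 0 <= W.
  by rewrite -(pmulr_rge0 _ N0) -varW; apply: sumr_ge0 => i _; exact: sqr_ge0.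
have cs : d ^+ 2 <= V * W.
  have := cauchy_schwarz_sum (fun i => N * (x i)^-1 - p) (fun i => N * x i - s).
  rewrite varV varW cov; under eq_bigr do rewrite mulVf ?gt_eqF //.
  rewrite sumr_const card_ord -NE -/p -/s.
  rewrite (_ : _ ^+ 2 = N ^+ 2 * d ^+ 2); last by rewrite /d; ring.
  rewrite (_ : N * V * _ = N ^+ 2 * (V * W)); last by ring.
  by rewrite ler_pM2l // exprn_gt0.
have VS0 : 0 <= V * s ^+ 2 by rewrite mulr_ge0 ?sqr_ge0.
have [n3|n4] : n = 3 \/ (4 <= n)%N by lia.
  subst n.
  have WQ : W <= 3 * s ^+ 2.
    have := sum_sqr_le_sqr_sum (fun i => ltW (x0 i)); rewrite -/s -/Q /W /N; lra.
  have pW : p ^+ 2 * W <= 27 * (V * s ^+ 2).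
    have := spread_comparison x0.
    rewrite -/s -/p -/q -/Q (_ : 4%:R = N :> R) -/W -/V; last by rewrite NE.
    by lra.
  have VW : V * W <= 3 * (V * s ^+ 2) by rewrite mulrCA ler_wpM2l.
  by rewrite /N; lra.
have n4' : 4 <= n%:R :> R by rewrite ler_nat.
have c1 : 0 <= n%:R * (n%:R ^+ 2 + 5 * n%:R - 26) :> R by nra.
have c2 : 0 <= 4 * n%:R * (3 * n%:R - 10) :> R by nra.
have c3 : 0 <= 6 * n%:R * (3 * n%:R - 2) :> R by nra.
have c4 : 0 <= (n%:R - 2) * (n%:R - 4) :> R by nra.
have D : 0 <= 2 * p ^+ 2 - (n%:R - 1) * V.
  rewrite (_ : _ - _ = N * (p ^+ 2 - (n%:R - 1) * q)); last by rewrite /V /N; ring.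
  by rewrite mulr_ge0 ?NE ?ler0n // ltW.
apply: addr_ge0; last exact: mulr_ge0 (mulr_ge0 c4 W0) D.
apply: addr_ge0; last by rewrite -mulrA; exact: mulr_ge0 c3 VS0.
apply: addr_ge0; first exact: mulr_ge0 c1 (sqr_ge0 d).
exact: mulr_ge0 (mulr_ge0 c2 (sqr_ge0 N)) d0.
Qed.

(** * Circumradius, edge-inradius and centroid *)

Theorem theorem2p2 (R : realType) (n : nat) (hn : (2 <= n)%N)
    (A : 'I_n.+1 -> 'rV[R]_n) (hA : is_simplex A)
    (O : 'rV[R]_n) (r : R) (hO : is_circumsphere A O r)
    (C : 'rV[R]_n) (rho : R) (hC : is_edge_tangent_sphere A C rho) :
  0 <= r ^+ 2 - (2 * n%:R) / (n%:R - 1) * rho ^+ 2 /\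
  r ^+ 2 - (2 * n%:R) / (n%:R - 1) * rho ^+ 2
    <= n.+1%:R ^+ 2 * edist O (centroid A) ^+ 2.
Proof.
have [x x0 []] := circumscriptible_relations hn hA hO hC.
have rho_gt0 : 0 < rho by case: hC.
have rho2_gt0 : 0 < rho ^+ 2 by rewrite exprn_gt0.
have m0 : 0 < n%:R - 1 :> R by rewrite subr_gt0 ltr1n.
set OC := dot _ _; have OC0 : 0 <= OC by exact: dot_ge0.
move=> e1 e2 e3 -> e5.
have D0 : 0 < (\sum_i (x i)^-1) ^+ 2 - (n%:R - 1) * \sum_i (x i)^-1 ^+ 2.
  by rewrite -(pmulr_rgt0 _ rho2_gt0) e1 mulr_gt0.
have hb := harmonic_bound x0.
split.
  rewrite -[r ^+ 2](subrK OC) e2.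
  rewrite (_ : _ - _ = OC + rho ^+ 2 / (2 * (n%:R - 1)) *
    ((\sum_i (x i)^-1) * (\sum_i x i) - n.+1%:R ^+ 2)); last first.
    by rewrite -natr1; field; rewrite gt_eqF.
  by rewrite addr_ge0 // mulr_ge0 ?subr_ge0 // divr_ge0 ?mulr_ge0 // ltW.
have [n2|n3] : n = 2 \/ (3 <= n)%N by lia.
  subst n.
  have := triangle_identity (fun i => lt0r_neq0 (x0 i)).
  move: e1 e2 e5; set p := \sum_i (x i)^-1; set s := \sum_i x i.
  set q := \sum_i (x i)^-1 ^+ 2; set Q := \sum_i x i ^+ 2.
  rewrite (_ : 2 - 1 = 1 :> R); last by ring.
  rewrite mul1r divr1 => e1 e2 e5 e6.
  have e7 : s ^+ 2 - Q = 2 * rho ^+ 2 * (p * s).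
    apply: (@mulfI _ 2); first by rewrite pnatr_eq0.
    transitivity (rho ^+ 2 * ((p ^+ 2 - q) * (s ^+ 2 - Q))).
      by rewrite mulrA e1 mulr1.
    by rewrite e6; ring.
  (* The gap is twice the inequality e5 plus a multiple of the identity e7. *)
  by rewrite divr1; lra.
rewrite -subr_ge0.
have := defect_identity n%:R (rho ^+ 2) _ _ _ _ OC (r ^+ 2)
  (lt0r_neq0 m0) (lt0r_neq0 D0) e1 e2.
rewrite natr1 => /(_ _ e3) e.
have c0 : 0 < 16 * (n%:R - 1) * n.+1%:R ^+ 2 :> R.
  by rewrite !mulr_gt0 // ltr0Sn.
rewrite -(pmulr_rge0 _ c0) e; apply: mulr_ge0; first exact: ltW.
by have := defect_ge0 n3 x0 D0; rewrite natr1.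
Qed.
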